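(* Let $q$ be a prime power, let $m,n,k$ be positive integers, let $\rho$ be a positive integer, let $\mathcal{U}$ be an $[n,k]_{q^m/q}$ system and let $\{u_1,\ldots,u_n\}$ be an $\mathbb{F}_q$-basis of $\mathcal{U}$. The following are equivalent: (a) $\mathcal{U}$ is rank-$\rho$-saturating. (b) For each vector $v\in \mathbb{F}_{q^m}^k$ there exists $\lambda=(\lambda_1,\ldots,\lambda_n)\in \mathbb{F}_{q^m}^{1\times n}$ with $\mathrm{wt}_{\mathrm{rk}}(\lambda)\le \rho$ such that $v=\lambda_1 u_1+\cdots+\lambda_n u_n$, and $\rho$ is the smallest integer with this property. (c) $\mathbb{F}_{q^m}^k=\bigcup_{\mathcal{S}} \langle \mathcal{S}\rangle_{\mathbb{F}_{q^m}}$, where the union runs over all $\mathbb{F}_q$-subspaces $\mathcal{S}\le \mathcal{U}$ with $\dim_{\mathbb{F}_q}\mathcal{S}\le \rho$, and $\rho$ is the smallest integer with this property.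
   Context: For $x=(x_1,\ldots,x_n)\in\mathbb{F}_{q^m}^{1\times n}$, the rank weight is $\mathrm{wt}_{\mathrm{rk}}(x)=\dim_{\mathbb{F}_q}\langle x_1,\ldots,x_n\rangle_{\mathbb{F}_q}$. An $[n,k]_{q^m/q}$ system is an $n$-dimensional $\mathbb{F}_q$-subspace $\mathcal{U}\le\mathbb{F}_{q^m}^k$ with $\langle\mathcal{U}\rangle_{\mathbb{F}_{q^m}}=\mathbb{F}_{q^m}^k$. Its linear set is $L_\mathcal{U}=\{\langle u\rangle_{\mathbb{F}_{q^m}}: u\in\mathcal{U}\setminus\{0\}\}\subseteq \mathrm{PG}(k-1,q^m)$. For an integer $r\ge 0$, a set $\mathcal{S}$ of points of $\mathrm{PG}(k-1,q^m)$ is $r$-saturating if every point of $\mathrm{PG}(k-1,q^m)$ lies in the projective subspace spanned by some $r+1$ points of $\mathcal{S}$, and $r$ is the smallest integer with this property. The system $\mathcal{U}$ is rank-$\rho$-saturating if $L_\mathcal{U}$ is a $(\rho-1)$-saturating set of $\mathrm{PG}(k-1,q^m)$. *)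

(* Defs.v *)
From HB Require Import structures.
From mathcomp Require Export all_boot all_order all_algebra all_field.
Set Implicit Arguments.
Unset Strict Implicit.
Unset Printing Implicit Defensive.
Import GRing.Theory.
Local Open Scope ring_scope.

(* For L an extension of F, the space L^k carries two linear structures on the *)
(* same (convertible) carrier: {vspace spaceF L k} is the type of F-subspaces  *)
(* of L^k, and {vspace spaceL L k} the type of L-subspaces.                    *)
Notation spaceF L k := {ffun 'I_k -> L}.
Notation spaceL L k := {ffun 'I_k -> L^o}.

Definition rank_weight (F : fieldType) (L : fieldExtType F) (n : nat)
    (x : 'rV[L]_n) : nat :=
  \dim <<[seq x 0 i | i : 'I_n]>>.

Definition in_Lspan (F : fieldType) (L : fieldExtType F) (k : nat)
    (S : {vspace spaceF L k}) (v : spaceL L k) : Prop :=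
  exists2 s : seq (spaceL L k), {subset s <= S} & v \in <<s>>%VS.

Definition is_system (F : fieldType) (L : fieldExtType F) (n k : nat)
    (U : {vspace spaceF L k}) : Prop :=
  \dim U = n /\ forall v : spaceL L k, in_Lspan U v.

Definition is_point (L : fieldType) (k : nat)
    (P : {vspace spaceL L k}) : Prop :=
  \dim P = 1%N.

Definition linear_set (F : fieldType) (L : fieldExtType F) (k : nat)
    (U : {vspace spaceF L k}) (P : {vspace spaceL L k}) : Prop :=
  exists2 u : spaceL L k, u \in U & u != 0 /\ P = <[u]>%VS.

Definition smallest (A : nat -> Prop) (r : nat) : Prop :=
  A r /\ forall s : nat, A s -> (r <= s)%N.

(* "Some r + 1 points" is read as r + 1 distinct points; the smallest such r   *)
(* is the same if repetitions are allowed.                                     *)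
Definition spans_points (L : fieldType) (k : nat)
    (S : {vspace spaceL L k} -> Prop) (r : nat) : Prop :=
  forall P : {vspace spaceL L k}, is_point P ->
    exists f : 'I_r.+1 -> {vspace spaceL L k},
      [/\ injective f, forall i, S (f i) & (P <= \sum_i f i)%VS].

Definition saturating (L : fieldType) (k : nat) (r : nat)
    (S : {vspace spaceL L k} -> Prop) : Prop :=
  smallest (spans_points S) r.

(* Only meaningful for 0 < rho, since 0.-1 = 0. *)
Definition rank_saturating (F : fieldType) (L : fieldExtType F) (k : nat)
    (rho : nat) (U : {vspace spaceF L k}) : Prop :=
  saturating rho.-1 (linear_set U).

(* Main.v *)
Require Import Defs.
From mathcomp Require Import all_boot all_order all_algebra all_field.
Set Implicit Arguments.
Unset Strict Implicit.
Unset Printing Implicit Defensive.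
Import GRing.Theory.
Local Open Scope ring_scope.

(** A vector of [<S>_L] is an [L]-combination of an [F]-basis of [S]; expanding
    that basis over [u], or conversely expanding the coefficients [lambda_i]
    over an [F]-basis of their span, exchanges a rank weight bound for a
    dimension bound.  An [F]-basis of [S] also gives at most [dim S] points of
    the linear set.  To have exactly [rho] distinct ones, further points are
    added: the linear set spans [L^k], hence has at least [k] points, and
    [rho <= k] because [k] vectors of [U] already span [L^k]. *)

(** * Free sequences and padding to a prescribed number of distinct elements *)

Section FreeSequences.

Variables (K : fieldType) (vT : vectType K).

Lemma span_free_subseq (s : seq vT) :
  exists t : seq vT, [/\ subseq t s, free t & <<t>>%VS = <<s>>%VS].
Proof.
elim: s => [|x s [t [sub_ts free_t eq_ts]]].
  by exists [::]; rewrite nil_free.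
have [x_in|x_notin] := boolP (x \in <<s>>%VS).
  exists t; split=> //; first exact: subseq_trans sub_ts (subseq_cons s x).
  by rewrite eq_ts span_cons; apply/esym/addv_idPr; rewrite -memvE.
exists (x :: t); split; first by rewrite /= eqxx.
  by rewrite free_cons eq_ts x_notin.
by rewrite !span_cons eq_ts.
Qed.

Lemma free_lines_uniq (t : seq vT) : free t -> uniq [seq <[x]>%VS | x <- t].
Proof.
elim: t => [//|x t IHt]; rewrite free_cons => /andP[x_notin free_t] /=.
rewrite IHt // andbT; apply: contra x_notin => /mapP[y y_in eq_xy].
by rewrite memvE eq_xy -memvE memv_span.
Qed.

End FreeSequences.

(** Remove repetitions from [X], append the elements of [E] outside [X], and cut at length [r]. The
    cut keeps all of [X], which comes first and has at most [r] distinct elements. *)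
Lemma distinct_padding (T : eqType) (X E : seq T) (r : nat) :
  (size X <= r)%N -> uniq E -> (r <= size E)%N ->
  exists Y : seq T,
    [/\ uniq Y, size Y = r, {subset X <= Y} & {subset Y <= X ++ E}].
Proof.
move=> leXr uniqE leEr; pose Z := undup X ++ [seq x <- E | x \notin X].
have uniqZ : uniq Z.
  rewrite cat_uniq undup_uniq filter_uniq // andbT; apply/hasPn => x.
  by rewrite mem_filter mem_undup => /andP[].
have leEZ : (size E <= size Z)%N.
  apply: uniq_leq_size => // x xE.
  by rewrite mem_cat mem_undup mem_filter xE andbT orbN.
have leX : (size (undup X) <= r)%N := leq_trans (size_undup X) leXr.
exists (take r Z); split.
- exact: take_uniq.
- by rewrite size_takel // (leq_trans leEr).
- move=> x xX; rewrite take_cat; case: ltnP => [ltr|_].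
    by move: (leq_ltn_trans leX ltr); rewrite ltnn.
  by rewrite mem_cat mem_undup xX.
- move=> x /mem_take; rewrite !mem_cat mem_undup mem_filter.
  by case/orP => [->|/andP[_ ->]] //; rewrite orbT.
Qed.

(** * Comparison of the two linear structures on [L^k] *)

Section TwoScalarFields.

Variables (F : fieldType) (L : fieldExtType F) (k : nat).

Lemma span_FL (X : seq (spaceF L k)) (w : spaceF L k) :
  w \in <<X>>%VS -> (w : spaceL L k) \in <<(X : seq (spaceL L k))>>%VS.
Proof.
move=> wX; have /coord_span w_def : w \in <<in_tuple X>>%VS by [].
have -> : (w : spaceL L k) = \sum_(i < size X)
    (coord (in_tuple X) i w)%:A *: ((in_tuple X)`_i : spaceL L k).
  apply/ffunP => j; rewrite {1}w_def !sum_ffunE; apply: eq_bigr => i _.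
  by rewrite !ffunE [RHS]mulr_algl.
apply: memv_suml => i _; apply/memvZ/memv_span.
exact: (mem_nth (0 : spaceF L k)).
Qed.

(** A fixed [F]-basis of [S] suffices: each vector of [S] is an [F]-combination of it, hence an
    [L]-combination. *)
Lemma in_LspanP (S : {vspace spaceF L k}) (v : spaceL L k) :
  in_Lspan S v <-> v \in <<(vbasis S : seq (spaceL L k))>>%VS.
Proof.
split=> [[s sS]|v_in].
  apply: subvP; apply/span_subvP => x /sS xS.
  by apply: span_FL; rewrite (span_basis (vbasisP S)).
by exists (vbasis S : seq (spaceL L k)) => // x;
  apply: (@vbasis_mem F (spaceF L k)).
Qed.

Lemma dim_spaceL : \dim {:spaceL L k} = k.
Proof. by rewrite dimvf /dim /= card_ord muln1. Qed.

(** An [F]-basis of [U] spans [L^k] over [L] and can be thinned to an [L]-free sequence. *)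
Lemma system_Lbasis (U : {vspace spaceF L k}) :
  (forall v : spaceL L k, in_Lspan U v) ->
  exists t : seq (spaceL L k),
    [/\ free t, size t = k, {subset t <= U} & <<t>>%VS = fullv].
Proof.
move=> U_full; have [t [sub_t free_t eq_t]] :=
  span_free_subseq (vbasis U : seq (spaceL L k)).
have t_full : <<t>>%VS = fullv.
  apply/eqP; rewrite eq_t eqEsubv subvf; apply/subvP => v _.
  exact/in_LspanP/U_full.
exists t; split=> //; last first.
  by move=> x /(mem_subseq sub_t); apply: (@vbasis_mem F (spaceF L k)).
by move: free_t; rewrite /free t_full dim_spaceL => /eqP.
Qed.

(** * Condition (c) at a fixed bound, compared with points of the linear set *)

Definition Lspan_covers (U : {vspace spaceF L k}) (r : nat) : Prop :=
  forall v : spaceL L k, exists2 S : {vspace spaceF L k},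
    (S <= U)%VS /\ (\dim S <= r)%N & in_Lspan S v.

Lemma Lspan_seq_subspace (U : {vspace spaceF L k}) (r : nat)
    (t : seq (spaceF L k)) (v : spaceL L k) :
  {subset t <= U} -> (size t <= r)%N -> v \in <<(t : seq (spaceL L k))>>%VS ->
  exists2 S : {vspace spaceF L k},
    (S <= U)%VS /\ (\dim S <= r)%N & in_Lspan S v.
Proof.
move=> tU le_tr vt; exists <<t>>%VS.
  by split; [apply/span_subvP | apply: leq_trans (dim_span t) le_tr].
by exists (t : seq (spaceL L k)) => // x; apply: (@memv_span F (spaceF L k)).
Qed.

Lemma Lspan_covers_dim (U : {vspace spaceF L k}) :
  (forall v : spaceL L k, in_Lspan U v) -> Lspan_covers U k.
Proof.
move=> /system_Lbasis[t [_ t_size tU t_full]] v.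
by apply: (@Lspan_seq_subspace _ _ t); rewrite ?t_size // t_full memvf.
Qed.

(** The zero subspace does not reach the all-ones vector. This makes the passage from [r] to [r.-1]
    faithful. *)
Lemma Lspan_covers_gt0 (U : {vspace spaceF L k}) (r : nat) :
  (0 < k)%N -> Lspan_covers U r -> (0 < r)%N.
Proof.
move=> k_gt0 cov; rewrite lt0n; apply/eqP => r0.
have [S [_]] := cov [ffun=> 1].
rewrite r0 leqn0 => dimS /in_LspanP.
rewrite (size0nil (s := vbasis S)) ?size_tuple; last exact/eqP.
rewrite span_nil memv0 => /eqP/ffunP/(_ (Ordinal k_gt0)).
by rewrite !ffunE => /eqP; rewrite oner_eq0.
Qed.

Lemma spans_points_Lspan_covers (U : {vspace spaceF L k}) (r : nat) :
  spans_points (linear_set U) r -> Lspan_covers U r.+1.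
Proof.
move=> sp v; have [->|v_neq0] := eqVneq v 0.
  by apply: (@Lspan_seq_subspace _ _ [::]); rewrite // mem0v.
have [|f [_ fU v_le]] := sp <[v]>%VS.
  by rewrite /is_point dim_vline v_neq0.
have /fin_all_exists[w wP] i : exists w : spaceL L k,
  w \in U /\ f i = <[w]>%VS by have [w wU [_ ->]] := fU i; exists w.
apply: (@Lspan_seq_subspace _ _ (codom w)).
- by move=> _ /codomP[i ->]; case: (wP i).
- by rewrite size_codom card_ord.
apply: (subvP (_ : \sum_i f i <= _)%VS); last by rewrite memvE.
apply/subv_sumP => i _; have [_ ->] := wP i.
by rewrite -memvE memv_span ?codom_f.
Qed.

(** Vectors free over [F] may be proportional over [L], so a basis of [S] may give fewer than [r.+1]
    points. The [k] distinct lines of an [L]-basis taken from [U] supply the missing ones, as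
    [r < k]. *)
Lemma Lspan_covers_spans_points (U : {vspace spaceF L k}) (r : nat) :
  (forall v : spaceL L k, in_Lspan U v) -> (r < k)%N ->
  Lspan_covers U r.+1 -> spans_points (linear_set U) r.
Proof.
move=> U_full lt_rk cov P P_point.
have [t [free_t t_size tU _]] := system_Lbasis U_full.
have [S [SU dimS] /in_LspanP P_S] := cov (vpick P).
pose lines (s : seq (spaceL L k)) := [seq <[x]>%VS | x <- s].
have b_neq0 : all (fun x : spaceL L k => x != 0) (vbasis S).
  by apply/allP => x xS; apply: (free_not0 (basis_free (vbasisP S))).
have t_neq0 : all (fun x : spaceL L k => x != 0) t.
  by apply/allP => x xt; apply: free_not0 xt.
have lines_U s : all (fun x : spaceL L k => x != 0) s -> {subset s <= U} ->
    forall Q, Q \in lines s -> linear_set U Q.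
  by move=> /allP s0 sU _ /mapP[x xs ->]; exists x; rewrite ?sU ?s0.
have [||Y [uniqY sizeY subXY subY]] :=
    @distinct_padding _ (lines (vbasis S)) (lines t) r.+1 _
      (free_lines_uniq free_t).
- by rewrite size_map size_tuple.
- by rewrite size_map t_size.
exists (fun i : 'I_r.+1 => nth 0%VS Y i); split.
- move=> i j /eqP; rewrite nth_uniq ?sizeY // => /eqP; exact: val_inj.
- move=> i; have /subY : nth 0%VS Y i \in Y by rewrite mem_nth ?sizeY.
  rewrite mem_cat => /orP[]; apply: lines_U => // x.
  by move=> /(@vbasis_mem F (spaceF L k)); apply: (subvP SU).
have -> : P = <[vpick P]>%VS.
  apply/esym/eqP; rewrite eqEdim -memvE memv_pick dim_vline vpick0.
  by rewrite P_point -dimv_eq0 P_point.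
rewrite -memvE; apply: subvP P_S; apply/span_subvP => x xS.
have /(nthP 0%VS)[i ltiY eq_i] : <[x]>%VS \in Y by apply/subXY/map_f.
rewrite memvE -eq_i sizeY in ltiY *.
exact: (sumv_sup (Ordinal ltiY)).
Qed.

(** * Condition (b) at a fixed bound, compared with condition (c) *)

Definition rank_covers (n : nat) (u : n.-tuple (spaceF L k)) (r : nat) : Prop :=
  forall v : spaceL L k, exists2 lambda : 'rV[L]_n,
    (rank_weight lambda <= r)%N &
    v = \sum_(i < n) lambda 0 i *: (tnth u i : spaceL L k).

Lemma rank_covers_Lspan_covers (n : nat) (U : {vspace spaceF L k})
    (u : n.-tuple (spaceF L k)) (r : nat) :
  basis_of U u -> rank_covers u r -> Lspan_covers U r.
Proof.
move=> u_basis cov v; have [lambda le_r v_def] := cov v.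
move: le_r; rewrite /rank_weight.
set W := <<_>>%VS => le_r; pose e := vbasis W.
pose c i j := coord e j (lambda 0 i).
(* Exchanging the sums turns the combination of the [u_i] into the sum of the [e_j w_j], with one
   [w_j] in [U] for each basis vector of [W]. *)
pose w (j : 'I_(\dim W)) : spaceF L k := \sum_(i < n) c i j *: tnth u i.
have lambda_def i : lambda 0 i = \sum_j c i j *: e`_j.
  by apply: coord_vbasis; apply/memv_span/map_f; rewrite mem_enum.
apply: (@Lspan_seq_subspace _ _ (codom w)).
- move=> _ /codomP[j ->]; apply: memv_suml => i _; apply: memvZ.
  by apply: (basis_mem u_basis); apply: mem_tnth.
- by rewrite size_codom card_ord.
have -> : v = \sum_(j < \dim W) e`_j *: (w j : spaceL L k).
  apply/ffunP => x; rewrite v_def !sum_ffunE.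
  under eq_bigr => i _ do rewrite ffunE lambda_def [_ *: _]mulr_suml.
  rewrite exchange_big /=; apply: eq_bigr => j _.
  rewrite ffunE /w sum_ffunE [RHS]mulr_sumr.
  by apply: eq_bigr => i _; rewrite ffunE -scalerAl -scalerAr.
by apply: memv_suml => j _; apply/memvZ/memv_span/codom_f.
Qed.

Lemma Lspan_covers_rank_covers (n : nat) (U : {vspace spaceF L k})
    (u : n.-tuple (spaceF L k)) (r : nat) :
  basis_of U u -> Lspan_covers U r -> rank_covers u r.
Proof.
move=> u_basis cov v; have [S [SU dimS] /in_LspanP] := cov v.
set b := vbasis S => v_in.
have v_def := coord_span (X := b : (\dim S).-tuple (spaceL L k)) v_in.
pose mu (j : 'I_(\dim S)) : L := coord (b : (\dim S).-tuple (spaceL L k)) j v.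
pose c i j := coord u i b`_j.
have b_def (j : 'I_(\dim S)) : b`_j = \sum_(i < n) c i j *: tnth u i.
  rewrite {1}(coord_basis u_basis (v := b`_j)).
    by apply: eq_bigr => i _; rewrite (tnth_nth 0).
  by apply/(subvP SU)/vbasis_mem/mem_nth; rewrite size_tuple.
(* All entries lie in the [F]-span of the [\dim S] scalars [mu j], which bounds the rank weight. *)
exists (\row_i \sum_(j < \dim S) c i j *: mu j).
  apply: leq_trans dimS; rewrite /rank_weight.
  rewrite -[leqRHS]card_ord -(size_codom mu); apply: leq_trans (dim_span _).
  apply/dimvS/span_subvP => _ /mapP[i _ ->]; rewrite mxE.
  by apply: memv_suml => j _; apply/memvZ/memv_span/codom_f.
apply/ffunP => x; rewrite [in LHS]v_def !sum_ffunE.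
under [RHS]eq_bigr => i _ do rewrite ffunE mxE [_ *: _]mulr_suml.
rewrite exchange_big /=; apply: eq_bigr => j _.
rewrite ffunE [(b : seq (spaceL L k))`_j](b_def j) sum_ffunE [LHS]mulr_sumr.
by apply: eq_bigr => i _; rewrite ffunE -scalerAl -scalerAr.
Qed.

End TwoScalarFields.

(** * Comparison of the smallest bounds *)

Lemma smallest_iff (A B : nat -> Prop) (r : nat) :
  (forall s, A s <-> B s) -> smallest A r -> smallest B r.
Proof. by move=> AB [Ar minA]; split=> [|s /AB/minA //]; apply/AB. Qed.

Theorem theorem2p3 (q m n k rho : nat) (F : finFieldType) (L : fieldExtType F)
    (U : {vspace spaceF L k}) (u : n.-tuple (spaceF L k))
    (card_F : #|F| = q) (dim_L : \dim {:L} = m)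
    (m_gt0 : (0 < m)%N) (n_gt0 : (0 < n)%N) (k_gt0 : (0 < k)%N)
    (rho_gt0 : (0 < rho)%N)
    (U_system : is_system n U) (u_basis : basis_of U u) :
  [<-> rank_saturating rho U;
       smallest (fun r : nat =>
         forall v : spaceL L k, exists2 lambda : 'rV[L]_n,
           (rank_weight lambda <= r)%N &
           v = \sum_(i < n) lambda 0 i *: (tnth u i : spaceL L k)) rho;
       smallest (fun r : nat =>
         forall v : spaceL L k, exists2 S : {vspace spaceF L k},
           (S <= U)%VS /\ (\dim S <= r)%N & in_Lspan S v) rho].
Proof.
have [_ U_full] := U_system.
have covers_iff r : rank_covers u r <-> Lspan_covers U r.
  split; first exact: rank_covers_Lspan_covers.
  exact: Lspan_covers_rank_covers.
have points_of_covers s : (s <= k)%N -> Lspan_covers U s ->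
    spans_points (linear_set U) s.-1.
  move=> le_sk cov; have s_gt0 := Lspan_covers_gt0 k_gt0 cov.
  by apply: Lspan_covers_spans_points; rewrite ?prednK.
tfae.
- move=> [sp min_sp]; apply: (@smallest_iff (Lspan_covers U)) => [s|].
    exact: iff_sym (covers_iff s).
  (* Coverings yield distinct points only for [s <= k]; a larger [s] is compared with [k], which is
     itself a covering bound. *)
  have min_k s : (s <= k)%N -> Lspan_covers U s -> (rho <= s)%N.
    move=> le_sk cov; have s_gt0 := Lspan_covers_gt0 k_gt0 cov.
    rewrite -(prednK rho_gt0) -(prednK s_gt0) ltnS.
    exact/min_sp/points_of_covers.
  split; first by rewrite -(prednK rho_gt0); apply: spans_points_Lspan_covers.
  move=> s cov; have [/min_k->//|/ltnW le_ks] := leqP s k.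
  exact: leq_trans (min_k _ (leqnn k) (Lspan_covers_dim U_full)) le_ks.
- exact: smallest_iff covers_iff.
- move=> [cov min_cov]; split.
    (* Minimality of [rho] gives [rho <= k], since [k] is a covering bound. *)
    by apply: points_of_covers => //; apply/min_cov/Lspan_covers_dim.
  (* Spanning by [s.+1] points gives the covering bound [s.+1], so [rho <= s.+1]. *)
  by move=> s /spans_points_Lspan_covers/min_cov; rewrite -subn1 leq_subLR.
Qed.
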